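(* Let $R$ be a commutative ring with $1$ and let $S$ be a commutative $R$-algebra. The following are equivalent. (1) $S$ is a Specker $R$-algebra. (2) $S$ is isomorphic (as an $R$-algebra) to $R[B]$ for some Boolean algebra $B$. (3) $S$ is isomorphic (as an $R$-algebra) to a Boolean power of $R$, i.e. to $C(X,R_{\mathrm{disc}})$ for some Stone space $X$. (4) There is a Boolean subalgebra $B$ of $\mathrm{Id}(S)$ such that $S$ is generated by $B$ and every Boolean homomorphism $\sigma: B\to\mathbf{2}$ lifts to an $R$-algebra homomorphism $\alpha: S\to R$ (that is, $\alpha(e)=\sigma(e)$ for all $e\in B$, where $\mathbf 2=\{0,1\}$ is regarded as consisting of the elements $0,1$ of $R$).
   Context: All algebras are commutative and unital and all algebra homomorphisms are unital. For a commutative $R$-algebra $S$, $\mathrm{Id}(S)$ is the set of idempotents of $S$, a Boolean algebra under $e\vee f=e+f-ef$, $e\wedge f=ef$, $\lnot e=1-e$. A Boolean subalgebra $B$ of $\mathrm{Id}(S)$ generates $S$ if $S$ is generated as an $R$-algebra by $B$. A nonzero idempotent $e\in S$ is faithful if for each $a\in R$, $ae=0$ implies $a=0$. A faithful generating algebra of idempotents of $S$ is a Boolean subalgebra $B$ of $\mathrm{Id}(S)$ that generates $S$ and all of whose nonzero elements are faithful. $S$ is a Specker $R$-algebra if it is a commutative $R$-algebra that has a faithful generating algebra of idempotents. For a Boolean algebra $B$, $R[B]$ denotes the quotient $R[\{x_e: e\in B\}]/I_B$ of the polynomial ring over $R$ in variables indexed by $B$ modulo the ideal $I_B$ generated by the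 elements $x_{e\wedge f}-x_ex_f$, $x_{e\vee f}-(x_e+x_f-x_ex_f)$, $x_{\lnot e}-(1-x_e)$, $x_0$, as $e,f$ range over $B$. A Stone space is a zero-dimensional compact Hausdorff space. The Boolean power of $R$ by a Boolean algebra $B$ is the $R$-algebra $C(X,R_{\mathrm{disc}})$ (pointwise operations) of continuous functions from the Stone space $X$ of $B$ to $R$ with the discrete topology. $\mathbf 2$ is the two-element Boolean algebra. The one-element Boolean algebra and the empty Stone space are allowed. *)

(* Defs.v *)
From HB Require Import structures.
From mathcomp Require Import all_boot all_order all_algebra.
From mathcomp Require Import ring finmap.
From mathcomp Require Import monalg.
From mathcomp Require Import boolp classical_sets functions.
From mathcomp Require Import topology_structure discrete_topology compact.
From mathcomp Require Import separation_axioms.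

Set Implicit Arguments.
Unset Strict Implicit.
Unset Printing Implicit Defensive.

Import Order.Theory GRing.Theory Quotient.

Local Open Scope classical_set_scope.
Local Open Scope ring_scope.

(* Rings and algebras are allowed to be trivial here: [R[B]] for the
   one-element Boolean algebra [B] and [C(X, R)] for empty [X] are the zero
   algebra.  MathComp's [comAlgType] requires [1 != 0], so an algebra is given
   instead by its structure morphism; [a *: u] is [alg_map a * u]. *)
HB.mixin Record ComPzRing_isPzAlgebra (R : comPzRingType) A
    of GRing.ComPzRing A := {
  alg_map : {rmorphism R -> A}
}.

#[short(type="comPzAlgType")]
HB.structure Definition ComPzAlgebra (R : comPzRingType) :=
  {A of GRing.ComPzRing A & ComPzRing_isPzAlgebra R A}.

HB.instance Definition _ (R : comPzRingType) :=
  ComPzRing_isPzAlgebra.Build R R^o (idfun : {rmorphism R -> R}).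

Section Algebras.
Variable R : comPzRingType.

Definition alg_hom (A B : comPzAlgType R) (f : A -> B) : Prop :=
  [/\ nmod_morphism f, monoid_morphism f
    & forall a : R, f (alg_map a) = alg_map a].

Definition alg_iso (A B : comPzAlgType R) : Prop :=
  exists f : A -> B, alg_hom f /\ bijective f.

Definition is_subalgebra (A : comPzAlgType R) (C : set A) : Prop :=
  [/\ forall a : R, C (alg_map a),
      forall u v : A, C u -> C v -> C (u + v)
    & forall u v : A, C u -> C v -> C (u * v)].

Definition generates_alg (A : comPzAlgType R) (G : set A) : Prop :=
  smallest (@is_subalgebra A) G = [set: A].

End Algebras.

Section BooleanSubalgebras.

Definition is_boolean_hom d d' (A : ctbDistrLatticeType d)
    (B : ctbDistrLatticeType d') (f : A -> B) : Prop :=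
  [/\ f \bot%O = \bot%O,
      f \top%O = \top%O,
      {morph f : e g / (e `&` g)%O},
      {morph f : e g / (e `|` g)%O}
    & {morph f : e / (~` e)%O}].

Record boolSubalg d (A : ctbDistrLatticeType d) := BoolSubalg {
  bs_pred :> {pred A};
  bs_bot : \bot%O \in bs_pred;
  bs_top : \top%O \in bs_pred;
  bs_meet : {in bs_pred &, forall e f, (e `&` f)%O \in bs_pred};
  bs_join : {in bs_pred &, forall e f, (e `|` f)%O \in bs_pred};
  bs_compl : {in bs_pred, forall e, (~` e)%O \in bs_pred}
}.

Variables (d : Order.disp_t) (A : ctbDistrLatticeType d) (B : boolSubalg A).

Record bs_sort := BsElt { bs_val : A; bs_valP : bs_val \in bs_pred B }.

HB.instance Definition _ := [isSub for bs_val].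
HB.instance Definition _ := [Choice of bs_sort by <:].

Let smeet (x y : bs_sort) := BsElt (bs_meet (bs_valP x) (bs_valP y)).
Let sjoin (x y : bs_sort) := BsElt (bs_join (bs_valP x) (bs_valP y)).
Let scompl (x : bs_sort) := BsElt (bs_compl (bs_valP x)).
Let sle (x y : bs_sort) := (bs_val x <= bs_val y)%O.
Let slt (x y : bs_sort) := (bs_val x < bs_val y)%O.

Fact bs_le_def x y : sle x y = (smeet x y == x).
Proof. by rewrite /sle leEmeet -val_eqE. Qed.
Fact bs_lt_def x y : slt x y = (y != x) && sle x y.
Proof. by rewrite /slt lt_def -val_eqE. Qed.
Fact bs_meetC : commutative smeet.
Proof. by move=> x y; apply: val_inj; exact: meetC. Qed.
Fact bs_joinC : commutative sjoin.
Proof. by move=> x y; apply: val_inj; exact: joinC. Qed.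
Fact bs_meetA : associative smeet.
Proof. by move=> x y z; apply: val_inj; exact: meetA. Qed.
Fact bs_joinA : associative sjoin.
Proof. by move=> x y z; apply: val_inj; exact: joinA. Qed.
Fact bs_joinKI y x : smeet x (sjoin x y) = x.
Proof. by apply: val_inj; exact: joinKI. Qed.
Fact bs_meetKU y x : sjoin x (smeet x y) = x.
Proof. by apply: val_inj; exact: meetKU. Qed.
Fact bs_meetUl : left_distributive smeet sjoin.
Proof. by move=> x y z; apply: val_inj; exact: meetUl. Qed.
Fact bs_meetxx : idempotent_op smeet.
Proof. by move=> x; apply: val_inj; exact: meetxx. Qed.

HB.instance Definition _ := Order.isMeetJoinDistrLattice.Build d bs_sort
  bs_le_def bs_lt_def bs_meetC bs_joinC bs_meetA bs_joinA bs_joinKI bs_meetKU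
  bs_meetUl bs_meetxx.

Fact bs_le0x (x : bs_sort) : (BsElt (bs_bot B) <= x)%O.
Proof. exact: (le0x (bs_val x)). Qed.
Fact bs_lex1 (x : bs_sort) : (x <= BsElt (bs_top B))%O.
Proof. exact: (lex1 (bs_val x)). Qed.

HB.instance Definition _ := Order.hasBottom.Build d bs_sort bs_le0x.
HB.instance Definition _ := Order.hasTop.Build d bs_sort bs_lex1.

Fact bs_joinxC (x : bs_sort) : (x `|` scompl x)%O = \top%O.
Proof. by apply: val_inj; exact: joinxC. Qed.
Fact bs_meetxC (x : bs_sort) : (x `&` scompl x)%O = \bot%O.
Proof. by apply: val_inj; exact: meetxC. Qed.

HB.instance Definition _ :=
  Order.TBDistrLattice_hasComplement.Build d bs_sort bs_joinxC bs_meetxC.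

End BooleanSubalgebras.

Section Idempotents.
Variable S : comPzRingType.

Record idem := Idem { idem_val : S; idemP : idem_val * idem_val == idem_val }.

HB.instance Definition _ := [isSub for idem_val].
HB.instance Definition _ := [Choice of idem by <:].

Implicit Types e f g : idem.

Local Notation "# e" := (idem_val e) (at level 2, format "# e").

Let idemE e : #e * #e = #e. Proof. exact/eqP/idemP. Qed.

Fact idem0_subproof : (0 : S) * 0 == 0. Proof. by rewrite mulr0. Qed.
Fact idem1_subproof : (1 : S) * 1 == 1. Proof. by rewrite mulr1. Qed.

Fact idem_meet_subproof e f : (#e * #f) * (#e * #f) == #e * #f.
Proof. by rewrite mulrACA !idemE. Qed.

Fact idem_compl_subproof e : (1 - #e) * (1 - #e) == 1 - #e.
Proof. by rewrite mulrBr mulr1 mulrBl mul1r idemE subrr subr0. Qed.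

Fact idem_join_subproof e f :
  (#e + #f - #e * #f) * (#e + #f - #e * #f) == #e + #f - #e * #f.
Proof.
have -> : #e + #f - #e * #f = 1 - (1 - #e) * (1 - #f) by ring.
pose c := Idem (idem_compl_subproof e); pose c' := Idem (idem_compl_subproof f).
exact: (idem_compl_subproof (Idem (idem_meet_subproof c c'))).
Qed.

Definition idem_meet e f := Idem (idem_meet_subproof e f).
Definition idem_join e f := Idem (idem_join_subproof e f).
Definition idem_compl e := Idem (idem_compl_subproof e).
Definition idem_le e f : bool := #e * #f == #e.
Definition idem_lt e f : bool := (f != e) && idem_le e f.

Fact idem_le_def e f : idem_le e f = (idem_meet e f == e).
Proof. by rewrite -val_eqE. Qed.
Fact idem_meetC : commutative idem_meet.
Proof. by move=> e f; apply: val_inj; exact: mulrC. Qed.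
Fact idem_joinC : commutative idem_join.
Proof. by move=> e f; apply: val_inj => /=; ring. Qed.
Fact idem_meetA : associative idem_meet.
Proof. by move=> e f g; apply: val_inj; exact: mulrA. Qed.
Fact idem_joinA : associative idem_join.
Proof. by move=> e f g; apply: val_inj => /=; ring. Qed.
Fact idem_joinKI f e : idem_meet e (idem_join e f) = e.
Proof.
by apply: val_inj; rewrite /= mulrBr mulrDr mulrA !idemE addrK.
Qed.
Fact idem_meetKU f e : idem_join e (idem_meet e f) = e.
Proof. by apply: val_inj; rewrite /= mulrA idemE addrK. Qed.
Fact idem_meetUl : left_distributive idem_meet idem_join.
Proof.
move=> e f g; apply: val_inj; rewrite /= mulrBl mulrDl.
by rewrite mulrACA idemE.
Qed.
Fact idem_meetxx : idempotent_op idem_meet.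
Proof. by move=> e; apply: val_inj; exact: idemE. Qed.

Fact idem_display : Order.disp_t. Proof. exact: (Order.Disp tt tt). Qed.

HB.instance Definition _ :=
  Order.isMeetJoinDistrLattice.Build idem_display idem
  idem_le_def (fun _ _ => erefl) idem_meetC idem_joinC idem_meetA idem_joinA
  idem_joinKI idem_meetKU idem_meetUl idem_meetxx.

Fact idem_le0x e : (Idem idem0_subproof <= e)%O.
Proof. exact/eqP/mul0r. Qed.
Fact idem_lex1 e : (e <= Idem idem1_subproof)%O.
Proof. exact/eqP/mulr1. Qed.

HB.instance Definition _ := Order.hasBottom.Build idem_display idem idem_le0x.
HB.instance Definition _ := Order.hasTop.Build idem_display idem idem_lex1.

Fact idem_joinxC e : (e `|` idem_compl e)%O = \top%O.
Proof.
by apply: val_inj; rewrite /= mulrBr mulr1 idemE subrr subr0 addrC subrK.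
Qed.
Fact idem_meetxC e : (e `&` idem_compl e)%O = \bot%O.
Proof. by apply: val_inj; rewrite /= mulrBr mulr1 idemE subrr. Qed.

HB.instance Definition _ :=
  Order.TBDistrLattice_hasComplement.Build idem_display idem
    idem_joinxC idem_meetxC.

End Idempotents.

Section Specker.
Variables (R : comPzRingType) (S : comPzAlgType R).

Definition generating (B : boolSubalg (idem S)) : Prop :=
  generates_alg [set idem_val e | e in [set` bs_pred B]].

Definition faithful (e : idem S) : Prop :=
  idem_val e <> 0 /\ forall a : R, alg_map a * idem_val e = 0 -> a = 0.

Definition faithful_generating (B : boolSubalg (idem S)) : Prop :=
  generating B /\
  {in bs_pred B, forall e : idem S, idem_val e <> 0 -> faithful e}.

Definition specker : Prop := exists B, faithful_generating B.

End Specker.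

(* [mvpoly R I] is the polynomial ring over [R] in variables indexed by [I].
   The ring structure of [{malg R[{cmonom I}]}] in [monalg] assumes [1 != 0]
   in [R]; the same product is reproduced here without that assumption. *)
Definition mvpoly (R : comPzRingType) (I : choiceType) : Type :=
  {malg R[{cmonom I}]}.

Lemma assoc_generators (V : zmodType) (T : Type) (g : T -> V)
    (m : V -> V -> V) :
  left_zero 0 m -> right_zero 0 m ->
  left_distributive m +%R -> right_distributive m +%R ->
  (forall Q : V -> Prop, Q 0 -> (forall p q, Q p -> Q q -> Q (p + q)) ->
    (forall x, Q (g x)) -> forall p, Q p) ->
  (forall x y z, m (g x) (m (g y) (g z)) = m (m (g x) (g y)) (g z)) ->
  associative m.
Proof.
move=> m0l m0r mDl mDr gI mA.
elim/gI=> [q r|p p' IHp IHp' q r|x]; first by rewrite !m0l.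
  by rewrite !mDl IHp IHp'.
elim/gI=> [r|q q' IHq IHq' r|y]; first by rewrite m0r !m0l m0r.
  by rewrite mDl !mDr mDl IHq IHq'.
by elim/gI=> [|r r' IHr IHr'|z //]; [rewrite !m0r | rewrite !mDr IHr IHr'].
Qed.

Section MvPoly.
Variables (R : comPzRingType) (I : choiceType).
Local Notation P := (mvpoly R I).
Local Notation mon := {cmonom I}.
Implicit Types p q r : P.

HB.instance Definition _ := GRing.Zmodule.on P.

Definition mvpolyC (a : R) : P := mkmalgU (mone : mon) a.
Definition mvpolyX (i : I) : P := mkmalgU (ucm i) 1.

Definition mvpoly_mul p q : P :=
  \sum_(k <- msupp p) \sum_(l <- msupp q) mkmalgU (mmul k l) (p@_k * q@_l).

Lemma mvpoly_mulw (d1 d2 : {fset mon}) p q :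
  (msupp p `<=` d1)%fset -> (msupp q `<=` d2)%fset ->
  mvpoly_mul p q =
  \sum_(k <- d1) \sum_(l <- d2) mkmalgU (mmul k l) (p@_k * q@_l).
Proof.
move=> le1 le2; rewrite /mvpoly_mul (big_fset_incl _ le1) /=.
  apply/eq_bigr => k _; apply/big_fset_incl => // l _ /mcoeff_outdom ->.
  by rewrite mulr0 monalgU0.
move=> k _ /mcoeff_outdom pk.
by rewrite big1 => // l _; rewrite pk mul0r monalgU0.
Qed.

Lemma mvpoly_mulC : commutative mvpoly_mul.
Proof.
move=> p q; rewrite /mvpoly_mul exchange_big /=.
by apply/eq_bigr => l _; apply/eq_bigr => k _; rewrite mulrC mulmC.
Qed.

Lemma mvpoly_mul0 p : mvpoly_mul 0 p = 0.
Proof. by rewrite /mvpoly_mul msupp0 big_seq_fset0. Qed.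

Lemma mvpoly_mulUU (k l : mon) (a b : R) :
  mvpoly_mul (mkmalgU k a) (mkmalgU l b) = mkmalgU (mmul k l) (a * b).
Proof. by rewrite (mvpoly_mulw msuppU_le msuppU_le) !big_seq_fset1 !mcoeffUU. Qed.

Lemma mvpoly_mulDl : left_distributive mvpoly_mul +%R.
Proof.
move=> p q r; have le := fsubset_refl (msupp r).
rewrite (mvpoly_mulw (msuppD_le p q) le).
rewrite (mvpoly_mulw (fsubsetUl _ (msupp q)) le).
rewrite (mvpoly_mulw (fsubsetUr (msupp p) _) le).
rewrite -big_split /=; apply/eq_bigr => k _.
rewrite -big_split /=; apply/eq_bigr => l _.
by rewrite mcoeffD mulrDl monalgUD.
Qed.

Lemma mvpoly_mulDr : right_distributive mvpoly_mul +%R.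
Proof. by move=> p q r; rewrite !(mvpoly_mulC p) mvpoly_mulDl. Qed.

Lemma mvpoly_ind (Q : P -> Prop) :
  Q 0 -> (forall p q, Q p -> Q q -> Q (p + q)) ->
  (forall (k : mon) (a : R), Q (mkmalgU k a)) -> forall p, Q p.
Proof.
move=> Q0 QD QU p; rewrite (monalgE p : p = _).
by elim/big_ind: _ => // k _; exact: QU.
Qed.

(* Rewriting with [mvpoly_mulUU] sends unification into the definition of
   [mkmalgU]; hence the explicit terms. *)
Let mulUUU (k l n : mon) (a b c : R) :
  mvpoly_mul (mkmalgU k a) (mvpoly_mul (mkmalgU l b) (mkmalgU n c)) =
  mvpoly_mul (mvpoly_mul (mkmalgU k a) (mkmalgU l b)) (mkmalgU n c).
Proof.
apply: etrans (congr1 (mvpoly_mul (mkmalgU k a)) (mvpoly_mulUU l n b c)) _.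
apply: etrans (mvpoly_mulUU k (mmul l n) a (b * c)) _.
apply: etrans (congr2 mkmalgU (mulmA k l n) (mulrA a b c)) _.
apply: etrans (esym (mvpoly_mulUU (mmul k l) n (a * b) c)) _.
exact: (congr1 (mvpoly_mul^~ (mkmalgU n c)) (esym (mvpoly_mulUU k l a b))).
Qed.

Lemma mvpoly_mulA : associative mvpoly_mul.
Proof.
apply: (@assoc_generators P (mon * R) (fun x => mkmalgU x.1 x.2)).
- exact: mvpoly_mul0.
- by move=> p; rewrite mvpoly_mulC mvpoly_mul0.
- exact: mvpoly_mulDl.
- exact: mvpoly_mulDr.
- by move=> Q Q0 QD Qg; apply: mvpoly_ind => // k a; exact: (Qg (k, a)).
- by move=> x y z; exact: (mulUUU x.1 y.1 z.1 x.2 y.2 z.2).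
Qed.

Lemma mvpoly_mul1 : left_id (mvpolyC 1) mvpoly_mul.
Proof.
elim/mvpoly_ind=> [|p q IHp IHq|k a].
- by rewrite mvpoly_mulC mvpoly_mul0.
- by rewrite mvpoly_mulDr IHp IHq.
by rewrite mvpoly_mulUU mul1r mul1m.
Qed.

HB.instance Definition _ := GRing.Zmodule_isComPzRing.Build P
  mvpoly_mulA mvpoly_mulC mvpoly_mul1 mvpoly_mulDl.

Fact mvpolyC_is_nmod_morphism : nmod_morphism mvpolyC.
Proof. by split=> [|a b]; [exact: monalgU0 | exact: monalgUD]. Qed.
Fact mvpolyC_is_monoid_morphism : monoid_morphism mvpolyC.
Proof. by split=> // a b; rewrite [RHS]mvpoly_mulUU mul1m. Qed.

HB.instance Definition _ :=
  GRing.isNmodMorphism.Build R P mvpolyC mvpolyC_is_nmod_morphism.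
HB.instance Definition _ :=
  GRing.isMonoidMorphism.Build R P mvpolyC mvpolyC_is_monoid_morphism.
HB.instance Definition _ := ComPzRing_isPzAlgebra.Build R P mvpolyC.

End MvPoly.

Section QuotientAlgebra.
Variables (R : comPzRingType) (A : comPzAlgType R) (G : set A).

Definition is_ideal (J : set A) : Prop :=
  [/\ J 0, forall u v : A, J u -> J v -> J (u + v)
    & forall a u : A, J u -> J (a * u)].

Definition ideal_of : set A := smallest is_ideal G.

Lemma ideal_ofP : is_ideal ideal_of.
Proof.
split=> [J [[]]//|u v hu hv J hJ|a u hu J hJ]; have [[_ JD JM] _] := hJ.
  by apply: JD; [exact: hu | exact: hv].
by apply: JM; exact: hu.
Qed.

Definition ideal_pred : {pred A} := fun x => `[< ideal_of x >].

Fact ideal_zmod_closed : zmod_closed ideal_pred.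
Proof.
have [I0 ID IM] := ideal_ofP.
split=> [|u v]; first exact/asboolP.
move=> /asboolP hu /asboolP hv; apply/asboolP; apply: ID => //.
by rewrite -mulN1r; apply: IM.
Qed.

HB.instance Definition _ :=
  GRing.isZmodClosed.Build A ideal_pred ideal_zmod_closed.

Definition quot_alg : Type := {quot ideal_pred}.
Local Notation Q := quot_alg.

HB.instance Definition _ := GRing.Zmodule.on Q.
HB.instance Definition _ := EqQuotient.on Q.

Definition quot_pi (u : A) : Q := (\pi_Q u)%qT.
Definition quot_one : Q := quot_pi 1.
Definition quot_mul (x y : Q) : Q := quot_pi (repr x * repr y).

Lemma quot_piP u v : quot_pi u = quot_pi v <-> ideal_of (u - v).
Proof.
split=> [/eqP|h]; first by rewrite -idealrBE => /asboolP.
by apply/eqP; rewrite -idealrBE; exact/asboolP.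
Qed.

Lemma quot_piK x : quot_pi (repr x) = x. Proof. exact: reprK. Qed.

Lemma quot_piM u v : quot_mul (quot_pi u) (quot_pi v) = quot_pi (u * v).
Proof.
have [I0 ID IM] := ideal_ofP; apply/quot_piP.
set u' := repr _; set v' := repr _.
have -> : u' * v' - u * v = v' * (u' - u) + u * (v' - v) by ring.
by apply: ID; apply: IM; apply/quot_piP; rewrite quot_piK.
Qed.

Lemma quot_piD u v : quot_pi (u + v) = quot_pi u + quot_pi v.
Proof. exact: pi_add. Qed.

Fact quot_mulA : associative quot_mul.
Proof.
move=> x y z; rewrite -[x]quot_piK -[y]quot_piK -[z]quot_piK.
by rewrite !quot_piM mulrA.
Qed.
Fact quot_mulC : commutative quot_mul.
Proof.
by move=> x y; rewrite -[x]quot_piK -[y]quot_piK !quot_piM mulrC.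
Qed.
Fact quot_mul1 : left_id quot_one quot_mul.
Proof. by move=> x; rewrite -[x]quot_piK quot_piM mul1r. Qed.
Fact quot_mulDl : left_distributive quot_mul +%R.
Proof.
move=> x y z; rewrite -[x]quot_piK -[y]quot_piK -[z]quot_piK.
by rewrite -quot_piD !quot_piM -quot_piD mulrDl.
Qed.

HB.instance Definition _ := GRing.Zmodule_isComPzRing.Build Q
  quot_mulA quot_mulC quot_mul1 quot_mulDl.

Definition quot_alg_map (a : R) : Q := quot_pi (alg_map a).

Fact quot_alg_map_is_nmod_morphism : nmod_morphism quot_alg_map.
Proof.
split=> [|a b]; rewrite /quot_alg_map ?rmorph0 ?rmorphD ?quot_piD //.
by apply: (@addrI _ (quot_pi 0)); rewrite -quot_piD !addr0.
Qed.
Fact quot_alg_map_is_monoid_morphism : monoid_morphism quot_alg_map.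
Proof.
by split=> [|a b]; rewrite /quot_alg_map ?rmorph1 ?rmorphM -?quot_piM.
Qed.

HB.instance Definition _ :=
  GRing.isNmodMorphism.Build R Q quot_alg_map quot_alg_map_is_nmod_morphism.
HB.instance Definition _ := GRing.isMonoidMorphism.Build R Q quot_alg_map
  quot_alg_map_is_monoid_morphism.
HB.instance Definition _ := ComPzRing_isPzAlgebra.Build R Q quot_alg_map.

End QuotientAlgebra.

Section BooleanAlgebraAlgebra.
Variables (R : comPzRingType) (d : Order.disp_t) (B : ctbDistrLatticeType d).
Local Notation x_ := (@mvpolyX R B).

Inductive boolean_rel : mvpoly R B -> Prop :=
| rel_meet e f : boolean_rel (x_ (e `&` f)%O - x_ e * x_ f)
| rel_join e f : boolean_rel (x_ (e `|` f)%O - (x_ e + x_ f - x_ e * x_ f))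
| rel_compl e : boolean_rel (x_ (~` e)%O - (1 - x_ e))
| rel_bot : boolean_rel (x_ \bot%O).

Definition boolean_algebra_alg : comPzAlgType R :=
  quot_alg (boolean_rel : set (mvpoly R B)).

End BooleanAlgebraAlgebra.

(* [zero_dimensional] in [separation_axioms] only asks that clopen sets
   separate points; zero-dimensionality proper is a base of clopen sets. *)
Definition stone_space (X : topologicalType) : Prop :=
  [/\ basis [set U : set X | clopen U], compact [set: X] & hausdorff_space X].

Definition boolean_power (R : comPzRingType) (X : topologicalType) : Type :=
  continuousType X (discrete_topology R).

Section BooleanPower.
Variables (R : comPzRingType) (X : topologicalType).
Local Notation C := (boolean_power R X).
Local Notation D := (discrete_topology R).

HB.instance Definition _ := Choice.on C.

Lemma continuous_op2 (op : R -> R -> R) (f g : C) :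
  continuous (fun x => op (f x) (g x) : D).
Proof.
move=> x; apply/discrete_cvg.
have nf : nbhs x (f @^-1` [set f x]).
  by apply: (cts_fun (s := f)); exact: discrete_set1.
have ng : nbhs x (g @^-1` [set g x]).
  by apply: (cts_fun (s := g)); exact: discrete_set1.
by apply: filterS2 nf ng => y /= -> ->.
Qed.

Definition bp_cst (a : R) : C := (cst a : X -> D).
Definition bp_add (f g : C) : C := mkcts (@continuous_op2 +%R f g).
Definition bp_mul (f g : C) : C := mkcts (@continuous_op2 *%R f g).
Definition bp_opp (f : C) : C := mkcts (@continuous_op2 (fun a _ => - a) f f).

Lemma bpP (f g : C) : (forall x, f x = g x) -> f = g.
Proof. by move=> h; apply/continuousEP. Qed.

Fact bp_addA : associative bp_add.
Proof. by move=> f g h; apply: bpP => x; exact: (@addrA R). Qed.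
Fact bp_addC : commutative bp_add.
Proof. by move=> f g; apply: bpP => x; exact: (@addrC R). Qed.
Fact bp_add0 : left_id (bp_cst 0) bp_add.
Proof. by move=> f; apply: bpP => x; exact: (@add0r R). Qed.
Fact bp_addN : left_inverse (bp_cst 0) bp_opp bp_add.
Proof. by move=> f; apply: bpP => x; exact: (@addNr R). Qed.
Fact bp_mulA : associative bp_mul.
Proof. by move=> f g h; apply: bpP => x; exact: (@mulrA R). Qed.
Fact bp_mulC : commutative bp_mul.
Proof. by move=> f g; apply: bpP => x; exact: (@mulrC R). Qed.
Fact bp_mul1 : left_id (bp_cst 1) bp_mul.
Proof. by move=> f; apply: bpP => x; exact: (@mul1r R). Qed.
Fact bp_mulDl : left_distributive bp_mul bp_add.
Proof. by move=> f g h; apply: bpP => x; exact: (@mulrDl R). Qed.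

HB.instance Definition _ :=
  GRing.isZmodule.Build C bp_addA bp_addC bp_add0 bp_addN.
HB.instance Definition _ := GRing.Zmodule_isComPzRing.Build C
  bp_mulA bp_mulC bp_mul1 bp_mulDl.

Fact bp_cst_is_nmod_morphism : nmod_morphism bp_cst.
Proof. by split=> [|a b]; apply: bpP. Qed.
Fact bp_cst_is_monoid_morphism : monoid_morphism bp_cst.
Proof. by split=> [|a b]; apply: bpP. Qed.

HB.instance Definition _ :=
  GRing.isNmodMorphism.Build R C bp_cst bp_cst_is_nmod_morphism.
HB.instance Definition _ :=
  GRing.isMonoidMorphism.Build R C bp_cst bp_cst_is_monoid_morphism.
HB.instance Definition _ := ComPzRing_isPzAlgebra.Build R C bp_cst.

End BooleanPower.

(* Main.v *)
(* The algebra [R[B]] is universal for maps [h] from [B] to the idempotents of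
   an algebra, and the induced morphism [R[B] -> A] is an isomorphism as soon as
   [h] generates [A] and [h e] is faithful for each [e != 0].  A Specker algebra
   provides such an [h] by definition.  The algebra of continuous functions on
   the Stone space of [B] provides another one, the indicators of the basic
   clopen sets: they are faithful by the Boolean prime ideal theorem and
   generate by compactness.  For a compact space [X], a homomorphism from the
   idempotents given by clopen sets to [bool] is membership of a point [x], so
   that evaluation at [x] lifts it.  Conversely, lifting a homomorphism that
   sends [e] to [true] maps [a e] to [a], whence [e] is faithful. *)
From HB Require Import structures.
Require Import Defs.
From mathcomp Require Import all_boot all_order all_algebra.
From mathcomp Require Import ring finmap monalg generic_quotient.
From mathcomp Require Import boolp classical_sets functions filter.
From mathcomp Require Import topology_structure discrete_topology compact.
From mathcomp Require Import separation_axioms.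

Set Implicit Arguments.
Unset Strict Implicit.
Unset Printing Implicit Defensive.

Import Order.Theory GRing.Theory.
Local Open Scope classical_set_scope.
Local Open Scope ring_scope.

(** * Algebra homomorphisms, isomorphisms and generating sets *)

Section AlgebraIsomorphisms.
Variable R : comPzRingType.
Implicit Types A B C : comPzAlgType R.

Lemma alg_homD A B (f : A -> B) : alg_hom f -> {morph f : u v / u + v}.
Proof. by case=> -[]. Qed.

Lemma alg_homM A B (f : A -> B) : alg_hom f -> {morph f : u v / u * v}.
Proof. by case=> _ []. Qed.

Lemma alg_hom_map A B (f : A -> B) :
  alg_hom f -> forall a, f (alg_map a) = alg_map a.
Proof. by case. Qed.

Lemma alg_hom0 A B (f : A -> B) : alg_hom f -> f 0 = 0.
Proof. by case=> -[]. Qed.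

Lemma alg_hom1 A B (f : A -> B) : alg_hom f -> f 1 = 1.
Proof. by case=> _ []. Qed.

Lemma alg_homB A B (f : A -> B) : alg_hom f -> {morph f : u v / u - v}.
Proof.
move=> hf u v; apply: (@addIr _ (f v)).
by rewrite -(alg_homD hf) !subrK.
Qed.

Lemma alg_hom_comp A B C (f : A -> B) (g : B -> C) :
  alg_hom f -> alg_hom g -> alg_hom (g \o f).
Proof.
move=> hf hg; split; first split.
- by rewrite /= (alg_hom0 hf) (alg_hom0 hg).
- by move=> u v; rewrite /= (alg_homD hf) (alg_homD hg).
- split=> [|u v]; rewrite /= ?(alg_hom1 hf) ?(alg_hom1 hg) //.
  by rewrite (alg_homM hf) (alg_homM hg).
by move=> a; rewrite /= (alg_hom_map hf) (alg_hom_map hg).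
Qed.

Lemma alg_hom_inv A B (f : A -> B) (g : B -> A) :
  alg_hom f -> cancel f g -> cancel g f -> alg_hom g.
Proof.
move=> hf fK gK; have fI := can_inj fK.
split; first split.
- by apply: fI; rewrite gK (alg_hom0 hf).
- by move=> u v; apply: fI; rewrite (alg_homD hf) !gK.
- by split=> [|u v]; apply: fI; rewrite ?(alg_homM hf) !gK ?(alg_hom1 hf).
by move=> a; apply: fI; rewrite gK (alg_hom_map hf).
Qed.

Lemma alg_iso_sym A B : alg_iso A B -> alg_iso B A.
Proof.
move=> [f [hf [g fK gK]]]; exists g; split; last by exists f.
exact: (alg_hom_inv hf).
Qed.

Lemma alg_iso_trans A B C : alg_iso A B -> alg_iso B C -> alg_iso A C.
Proof.
move=> [f [hf bf]] [g [hg bg]]; exists (g \o f); split.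
  exact: alg_hom_comp.
exact: bij_comp.
Qed.

Lemma alg_hom_preimage A B (f : A -> B) (D : set B) :
  alg_hom f -> is_subalgebra D -> is_subalgebra (f @^-1` D)%classic.
Proof.
move=> hf [Da DD DM]; split=> [a|u v|u v] /=.
- by rewrite (alg_hom_map hf).
- by rewrite (alg_homD hf); exact: DD.
by rewrite (alg_homM hf); exact: DM.
Qed.

Lemma alg_hom_range A B (f : A -> B) :
  alg_hom f -> is_subalgebra (range f).
Proof.
move=> hf; split=> [a|_ _ [u _ <-] [v _ <-]|_ _ [u _ <-] [v _ <-]].
- by exists (alg_map a); rewrite // (alg_hom_map hf).
- by exists (u + v); rewrite // (alg_homD hf).
by exists (u * v); rewrite // (alg_homM hf).
Qed.

(** Turns generation into an induction principle: a property that defines a subalgebra and holds on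
    [G] holds everywhere. *)
Lemma generates_algP A (G : set A) :
  generates_alg G <->
  forall D : set A, is_subalgebra D -> (G `<=` D)%classic -> forall u, D u.
Proof.
split=> [gG D Dalg GD u|h].
  have : smallest (@is_subalgebra R A) G u by rewrite gG.
  by apply.
apply/seteqP; split=> [//|u _ D [Dalg GD]]; exact: h.
Qed.

End AlgebraIsomorphisms.

(** * Polynomials: evaluation in an algebra and generation by the variables *)

Section PolynomialEvaluation.
Variables (R : comPzRingType) (I : choiceType) (A : comPzAlgType R).
Variable h : I -> A.
Local Notation mon := {cmonom I}.
Implicit Types (k l : mon) (p q : mvpoly R I).

Definition mon_eval k : A := \prod_(i <- finsupp k) h i ^+ k i.

(** Exponents vanish off the support, so monomials with different supports can be compared over a
    common index set. *)
Lemma mon_evalw k (d : {fset I}) : (finsupp k `<=` d)%fset ->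
  mon_eval k = \prod_(i <- d) h i ^+ k i.
Proof.
move=> le; rewrite /mon_eval (big_fset_incl _ le) //= => i _.
by rewrite -cmE_eq0 => /eqP ->; rewrite expr0.
Qed.

Lemma mon_eval1 : mon_eval mone = 1.
Proof. by rewrite /mon_eval mdom1 big_seq_fset0. Qed.

Lemma mon_evalU i : mon_eval (ucm i) = h i.
Proof. by rewrite /mon_eval mdomU big_seq_fset1 cmUU expr1. Qed.

Lemma mon_evalM k l : mon_eval (mmul k l) = mon_eval k * mon_eval l.
Proof.
rewrite (mon_evalw (fsubset_refl _)) mdomD.
rewrite (mon_evalw (fsubsetUl _ (finsupp l))).
rewrite (mon_evalw (fsubsetUr (finsupp k) _)) -big_split /=.
by apply/eq_bigr => i _; rewrite cmM exprD.
Qed.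

Definition mvpoly_eval p : A :=
  \sum_(k <- msupp p) alg_map p@_k * mon_eval k.

Lemma mvpoly_evalw p (d : {fset mon}) : (msupp p `<=` d)%fset ->
  mvpoly_eval p = \sum_(k <- d) alg_map p@_k * mon_eval k.
Proof.
move=> le; rewrite /mvpoly_eval (big_fset_incl _ le) //= => k _.
by move/mcoeff_outdom ->; rewrite rmorph0 mul0r.
Qed.

Lemma mvpoly_evalU k (a : R) :
  mvpoly_eval (mkmalgU k a) = alg_map a * mon_eval k.
Proof. by rewrite (mvpoly_evalw msuppU_le) big_seq_fset1 mcoeffUU. Qed.

Lemma mvpoly_eval0 : mvpoly_eval 0 = 0.
Proof. by rewrite /mvpoly_eval msupp0 big_seq_fset0. Qed.

Lemma mvpoly_evalD : {morph mvpoly_eval : p q / p + q}.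
Proof.
move=> p q; rewrite (mvpoly_evalw (msuppD_le p q)).
rewrite (mvpoly_evalw (fsubsetUl _ (msupp q))).
rewrite (mvpoly_evalw (fsubsetUr (msupp p) _)) -big_split /=.
by apply/eq_bigr => k _; rewrite mcoeffD rmorphD mulrDl.
Qed.

Lemma mvpoly_evalM : {morph mvpoly_eval : p q / p * q}.
Proof.
(* The equations are given explicitly because [rewrite] would try to unify
   distinct products by unfolding them. *)
move=> p q; elim/mvpoly_ind: p => [|p p' IHp IHp'|k a].
- by rewrite mul0r mvpoly_eval0 mul0r.
-apply: etrans (congr1 mvpoly_eval (mulrDl p p' q)) _.
  apply: etrans (mvpoly_evalD (p * q) (p' * q)) _.
  apply: etrans (congr2 +%R IHp IHp') _.
  apply: etrans (esym (mulrDl _ _ _)) _.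
  exact: (congr1 (fun x => x * _) (esym (mvpoly_evalD p p'))).
pose u : mvpoly R I := mkmalgU k a.
rewrite -/u; elim/mvpoly_ind: q => [|q q' IHq IHq'|l b].
- by rewrite mulr0 mvpoly_eval0 mulr0.
-apply: etrans (congr1 mvpoly_eval (mulrDr u q q')) _.
  apply: etrans (mvpoly_evalD _ _) _.
  apply: etrans (congr2 +%R IHq IHq') _.
  apply: etrans (esym (mulrDr _ _ _)) _.
  exact: (congr1 (fun x => _ * x) (esym (mvpoly_evalD q q'))).
apply: etrans (congr1 mvpoly_eval (mvpoly_mulUU k l a b)) _.
apply: etrans (mvpoly_evalU _ _) _.
apply: etrans (esym (congr2 *%R (mvpoly_evalU k a) (mvpoly_evalU l b))).
by rewrite rmorphM mon_evalM mulrACA.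
Qed.

Lemma mvpoly_evalX i : mvpoly_eval (mvpolyX R i) = h i.
Proof. by rewrite mvpoly_evalU rmorph1 mul1r mon_evalU. Qed.

Lemma mvpoly_eval_hom : alg_hom mvpoly_eval.
Proof.
have evalC a : mvpoly_eval (mvpolyC I a) = alg_map a.
  by rewrite mvpoly_evalU mon_eval1 mulr1.
split=> //.
  by split; [exact: mvpoly_eval0 | exact: mvpoly_evalD].
split; last exact: mvpoly_evalM.
by rewrite -[X in mvpoly_eval X]/(mvpolyC I 1) evalC rmorph1.
Qed.

End PolynomialEvaluation.

Lemma mvpoly_generated (R : comPzRingType) (I : choiceType) :
  generates_alg (range (@mvpolyX R I)).
Proof.
apply/generates_algP => D [DC DD DM] DX.
(* Constants lie in [D], so monomials with coefficient [1] suffice; these are reached by induction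
   on the degree, splitting off one variable at a time. *)
suff DU1 n k : mdeg k = n -> D (mkmalgU k 1).
  elim/mvpoly_ind=> [|p q|k a]; [|exact: DD|].
    by have := DC 0; rewrite rmorph0.
  have := DM _ _ (DC a) (DU1 _ k erefl).
  suff -> : (alg_map a : mvpoly R I) * mkmalgU k 1 = mkmalgU k a by [].
  apply: etrans (mvpoly_mulUU mone k a 1) _.
  by rewrite mulr1 mul1m.
elim: n k => [k /mdeg_eq0I -> | n IHn k kn].
  by have := DC 1.
have [i ki] : exists i, i \in finsupp k.
  apply/fset0Pn/eqP => k0.
  by move: kn; rewrite mdegE k0 big_seq_fset0.
have kE : k = mmul (ucm i) (divcm k (ucm i)).
  apply/eqP/cmP => j; rewrite cmM divcmE cmU subnKC //.
  by case: eqVneq => // <-; rewrite lt0n cmE_neq0.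
have := DM _ _ (DX _ (imageT _ i)) (IHn (divcm k (ucm i)) _).
rewrite [mvpolyX R i * _](mvpoly_mulUU (ucm i) (divcm k (ucm i)) 1 1) -kE mulr1.
by apply; move: kn; rewrite {1}kE mdegM mdegU => -[].
Qed.

(** * Homomorphisms into and out of a quotient algebra *)

Section QuotientMorphisms.
Variables (R : comPzRingType) (A C : comPzAlgType R) (G : set A).

Lemma quot_pi_hom : alg_hom (quot_pi G).
Proof.
split=> //; split.
- apply: (@addrI _ (quot_pi G 0)).
  by apply: etrans (esym (quot_piD G 0 0)) _; rewrite !addr0.
- exact: quot_piD.
- by [].
by move=> u v; apply/esym/quot_piM.
Qed.

(** The kernel of [f] is an ideal containing [G], hence contains [ideal_of G]; so the value of [f]
    at a representative does not depend on its choice. *)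
Lemma quot_lift (f : A -> C) : alg_hom f -> (forall u, G u -> f u = 0) ->
  exists2 g : quot_alg G -> C, alg_hom g & forall u, g (quot_pi G u) = f u.
Proof.
move=> hf fG0.
have fI u : ideal_of G u -> f u = 0.
  apply: (_ : ideal_of G `<=` [set u | f u = 0])%classic.
  apply: smallest_sub => //; split=> /=.
  - exact: (alg_hom0 hf).
  - by move=> v w v0 w0; rewrite (alg_homD hf) v0 w0 addr0.
  - by move=> a v v0; rewrite (alg_homM hf) v0 mulr0.
have fE u v : quot_pi G u = quot_pi G v -> f u = f v.
  move=> /quot_piP/fI; rewrite (alg_homB hf) => fuv.
  by apply: (@addIr _ (- f v)); rewrite fuv subrr.
pose g (x : quot_alg G) := f (generic_quotient.repr x).
have gE u : g (quot_pi G u) = f u by apply: fE; exact: quot_piK.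
have hpi := quot_pi_hom; exists g => //; split.
- split; first by rewrite -(alg_hom0 hpi) gE (alg_hom0 hf).
  move=> x y; rewrite -[x]quot_piK -[y]quot_piK -(alg_homD hpi) !gE.
  exact: (alg_homD hf).
- split; first by rewrite -(alg_hom1 hpi) gE (alg_hom1 hf).
  move=> x y; rewrite -[x]quot_piK -[y]quot_piK -(alg_homM hpi) !gE.
  exact: (alg_homM hf).
by move=> a; rewrite -(alg_hom_map hpi) gE (alg_hom_map hf).
Qed.

End QuotientMorphisms.

(** These are the Boolean homomorphisms from [B] to [Id(A)], written with elements of [A]: the meet
    rule for two equal arguments makes the values idempotent, and the value at top is [1] by
    complementing bottom. *)
Definition boolean_valued (R : comPzRingType) (A : comPzAlgType R)
    d (B : ctbDistrLatticeType d) (h : B -> A) : Prop :=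
  [/\ {morph h : e f / (e `&` f)%O >-> e * f},
      {morph h : e f / (e `|` f)%O >-> e + f - e * f},
      {morph h : e / (~` e)%O >-> 1 - e}
    & h \bot%O = 0].

(** * The universal property of [R[B]] and linear combinations of idempotents *)

Section BooleanValued.
Variables (R : comPzRingType) (d : Order.disp_t) (B : ctbDistrLatticeType d).
Local Notation RB := (boolean_algebra_alg R B).
Local Notation rel := (@boolean_rel R d B : set (mvpoly R B)).

Definition boolean_gen (e : B) : RB := quot_pi _ (mvpolyX R e).

Lemma boolean_gen_valued : boolean_valued boolean_gen.
Proof.
have hpi := quot_pi_hom rel.
have piE u v : rel (u - v) -> quot_pi rel u = quot_pi rel v.
  by move=> uv; apply/quot_piP => J [_]; exact.
rewrite /boolean_gen; split=> [e f|e f|e|].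
- by rewrite -(alg_homM hpi); apply: piE; exact: rel_meet.
- rewrite -(alg_homM hpi) -(alg_homD hpi) -(alg_homB hpi).
  by apply: piE; exact: rel_join.
- by rewrite -(alg_hom1 hpi) -(alg_homB hpi); apply: piE; exact: rel_compl.
by rewrite -(alg_hom0 hpi); apply: piE; rewrite subr0; exact: rel_bot.
Qed.

(** The preimage in the polynomial ring of a subalgebra containing the generators is a subalgebra
    containing the variables. *)
Lemma boolean_gen_generates : generates_alg (range boolean_gen).
Proof.
apply/generates_algP => D Dalg DG u; rewrite -[u]quot_piK.
have hpi := quot_pi_hom rel.
move: (generic_quotient.repr u) => p.
apply: (proj1 (generates_algP _) (mvpoly_generated R B) _
  (alg_hom_preimage hpi Dalg)).
by move=> _ [e _ <-]; apply: DG; exists e.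
Qed.

Variables (A : comPzAlgType R) (h : B -> A).
Hypothesis hB : boolean_valued h.

Lemma boolean_lift : exists2 phi : RB -> A,
  alg_hom phi & forall e, phi (boolean_gen e) = h e.
Proof.
have [hI hU hC h0] := hB.
have hev := mvpoly_eval_hom h.
have [|phi hphi phiE] := quot_lift (G := rel) hev.
  have evX := @mvpoly_evalX R B A h.
  (* Abstracting the variables keeps unification from unfolding them. *)
  move=> _ [e f|e f|e|]; move: (@mvpolyX R B) evX => X evX.
  - by rewrite (alg_homB hev) (alg_homM hev) !evX hI subrr.
  - by rewrite !(alg_homB hev) (alg_homD hev) (alg_homM hev) !evX hU subrr.
  - by rewrite !(alg_homB hev) (alg_hom1 hev) !evX hC subrr.
  - by rewrite evX.
by exists phi => // e; rewrite phiE mvpoly_evalX.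
Qed.

Definition boolean_comb (s : seq (R * B)) : A :=
  \sum_(p <- s) alg_map p.1 * h p.2.

Lemma alg_hom_comb (C : comPzAlgType R) (f : A -> C) s :
  alg_hom f -> f (boolean_comb s) = \sum_(p <- s) alg_map p.1 * f (h p.2).
Proof.
move=> hf; rewrite /boolean_comb (big_morph f (alg_homD hf) (alg_hom0 hf)).
by apply: eq_bigr => p _; rewrite (alg_homM hf) (alg_hom_map hf).
Qed.

Lemma boolean_valued_top : h \top%O = 1.
Proof. by case: hB => _ _ hC h0; rewrite -compl0 hC h0 subr0. Qed.

(** A product of values of [h] is again a value of [h], so linear combinations are already closed
    under multiplication. *)
Lemma boolean_comb_alg : is_subalgebra (range boolean_comb).
Proof.
have [hI _ _ _] := hB; split.
- move=> a; exists [:: (a, \top%O)] => //.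
  by rewrite /boolean_comb big_seq1 boolean_valued_top mulr1.
- move=> _ _ [s _ <-] [t _ <-]; exists (s ++ t) => //.
  exact: big_cat.
move=> _ _ [s _ <-] [t _ <-].
exists [seq (p.1 * q.1, (p.2 `&` q.2)%O) | p <- s, q <- t] => //.
rewrite /boolean_comb big_allpairs_dep /= mulr_suml.
apply: eq_bigr => p _; rewrite mulr_sumr; apply: eq_bigr => q _ /=.
by rewrite rmorphM hI mulrACA.
Qed.

Lemma boolean_comb_span : generates_alg (range h) ->
  forall u, exists s, u = boolean_comb s.
Proof.
move=> /generates_algP gh u.
suff [s _ <-] : range boolean_comb u by exists s.
apply: gh; first exact: boolean_comb_alg.
move=> _ [e _ <-]; exists [:: (1, e)] => //.
by rewrite /boolean_comb big_seq1 rmorph1 mul1r.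
Qed.

End BooleanValued.

(** * Faithful generating idempotents give a copy of [R[B]] *)

Section BooleanAlgebraIso.
Variables (R : comPzRingType) (d : Order.disp_t) (B : ctbDistrLatticeType d).
Variables (A : comPzAlgType R) (h : B -> A).
Hypothesis hB : boolean_valued h.
Hypothesis h_faithful :
  forall e (a : R), e <> \bot%O -> alg_map a * h e = 0 -> a = 0.
Local Notation RB := (boolean_algebra_alg R B).

(* Splitting [f] along the idempotent of the first term of the combination
   absorbs the coefficient of that term into [c], on each half. *)
Lemma boolean_comb_eq0 (C : comPzAlgType R) (x : B -> C) s f (c : R) :
  boolean_valued x ->
  (alg_map c + boolean_comb h s) * h f = 0 ->
  (alg_map c + boolean_comb x s) * x f = 0.
Proof.
have [hI hU hC h0] := hB; case=> xI xU xC x0.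
elim: s f c => [f c|[a e] s IHs f c].
  rewrite /boolean_comb !big_nil !addr0 => cf.
  (* Faithfulness enters here: for nonzero [f], the scalar [c] killing [h f] must be [0]. *)
  have [->|/eqP f0] := eqVneq f \bot%O; first by rewrite x0 mulr0.
  by rewrite (h_faithful f0 cf) rmorph0 mul0r.
rewrite /boolean_comb !big_cons -!/(boolean_comb _ s) /= => cf.
have xf : x f = x (e `&` f)%O + x (~` e `&` f)%O.
  by rewrite !xI xC; ring.
have idem y : h y * h y = h y by rewrite -hI meetxx.
have xidem y : x y * x y = x y by rewrite -xI meetxx.
have ef : (alg_map (c + a) + boolean_comb x s) * x (e `&` f)%O = 0.
  apply: IHs; rewrite hI rmorphD.
  (* The second summand vanishes by idempotency of [h e]; adding it makes the equality an identity
     of commutative rings. *)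
  transitivity (h e * ((alg_map c + (alg_map a * h e + boolean_comb h s)) * h f)
    + alg_map a * h f * (h e - h e * h e)); first by ring.
  by rewrite cf idem subrr !mulr0 addr0.
have ef' : (alg_map c + boolean_comb x s) * x (~` e `&` f)%O = 0.
  apply: IHs; rewrite hI hC.
  transitivity ((1 - h e) *
    ((alg_map c + (alg_map a * h e + boolean_comb h s)) * h f)
    + alg_map a * h f * (h e * h e - h e)); first by ring.
  by rewrite cf idem subrr !mulr0 addr0.
(* The two halves add up to the claim on [f], because [x e] and [1 - x e] sum to [1]; the last
   summand is zero. *)
transitivity ((alg_map (c + a) + boolean_comb x s) * x (e `&` f)%O +
  (alg_map c + boolean_comb x s) * x (~` e `&` f)%O +
  alg_map a * x f * (x e * x e - x e) * (1 - 1)); last first.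
  by rewrite ef ef' subrr mulr0 !addr0.
by rewrite !xI xC rmorphD; ring.
Qed.

(** The induced morphism is onto because its range is a subalgebra containing the values of [h]. It
    is injective because every element of [R[B]] is a linear combination of generators, and
    [boolean_comb_eq0] transports the vanishing of a combination from [A] back to [R[B]]. *)
Lemma boolean_algebra_alg_iso :
  generates_alg (range h) -> alg_iso RB A.
Proof.
move=> /generates_algP gh.
pose gen := @boolean_gen R d B; have genB := boolean_gen_valued R B.
have [phi hphi phiE] := boolean_lift hB.
have phi_comb s : phi (boolean_comb gen s) = boolean_comb h s.
  rewrite (alg_hom_comb gen s hphi); apply: eq_bigr => p _.
  by rewrite /= phiE.
have phi_ker u : phi u = 0 -> u = 0.
  have [s ->] := boolean_comb_span genB
    (boolean_gen_generates R B) u.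
  rewrite phi_comb => s0.
  have := boolean_comb_eq0 (s := s) (f := \top%O) (c := 0) genB.
  rewrite (boolean_valued_top hB) (boolean_valued_top genB).
  by rewrite !rmorph0 !add0r !mulr1; apply.
have phi_inj : injective phi.
  move=> u v uv; apply/eqP; rewrite -subr_eq0; apply/eqP/phi_ker.
  by rewrite (alg_homB hphi) uv subrr.
have phi_surj u : exists v, phi v = u.
  suff [v _ <-] : range phi u by exists v.
  apply: gh; first exact: alg_hom_range.
  by move=> _ [e _ <-]; exists (gen e).
exists phi; split=> //.
have [g gE] := choice phi_surj.
by exists g => // v; apply: phi_inj; rewrite gE.
Qed.

End BooleanAlgebraIso.

(** * The Boolean prime ideal theorem *)

Section Ultrafilters.
Variables (d : Order.disp_t) (B : ctbDistrLatticeType d).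
Implicit Types (F : set B) (b e : B).

Definition proper_boolean_filter F : Prop :=
  [/\ F \top%O, forall b c, F b -> (b <= c)%O -> F c,
      forall b c, F b -> F c -> F (b `&` c)%O & ~ F \bot%O].

Lemma ultrafilter_boolean_hom F : proper_boolean_filter F ->
  (forall b, F b \/ F (~` b)%O) -> is_boolean_hom (fun b => `[< F b >]).
Proof.
move=> [F1 Fle FI F0] Fultra.
have FC b : F (~` b)%O <-> ~ F b.
  split=> [nb Fb|nb]; last by case: (Fultra b).
  by apply: F0; rewrite -(meetxC b); exact: FI.
have FIE b c : F (b `&` c)%O <-> F b /\ F c.
  split=> [bc|[]]; last exact: FI.
  by split; apply: Fle bc _; [exact: leIl | exact: leIr].
have FUE b c : F (b `|` c)%O <-> F b \/ F c.
  split=> [bc|[] Fx]; [|exact: Fle Fx (leUl _ _)|exact: Fle Fx (leUr _ _)].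
  apply: contrapT => /not_orP[/FC nb /FC nc].
  by apply: (proj1 (FC _)) bc; rewrite complU; exact: FI.
split.
- exact/asboolPn.
- exact/asboolP.
- by move=> b c; rewrite (propext (FIE b c)) asbool_and.
- by move=> b c; rewrite (propext (FUE b c)) asbool_or.
by move=> b; rewrite (propext (FC b)) asbool_neg.
Qed.

Lemma exists_boolean_hom e : e <> \bot%O ->
  exists2 sigma : B -> bool, is_boolean_hom sigma & sigma e.
Proof.
move=> e0; pose P F := F = set0 \/ (proper_boolean_filter F /\ F e).
have [|M [PM Mmax]] := @Zorn_bigcup B P.
  move=> C CP Ctot; have [[F0 CF0 [b0 F0b0]]|C0] :=
    pselect (exists2 F, C F & F !=set0); last first.
    left; apply/seteqP; split=> // b [F CF Fb].
    by exfalso; apply: C0; exists F => //; exists b.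
  have Cprop F b : C F -> F b -> proper_boolean_filter F /\ F e.
    by move=> CF Fb; case: (CP F CF) => // F_0; move: Fb; rewrite F_0.
  have [[T0 _ _ _] e_in] := Cprop _ _ CF0 F0b0.
  right; split; last by exists F0.
  split; first by exists F0.
  - move=> b c [F CF Fb] bc; exists F => //.
    by have [[_ Fle _ _] _] := Cprop _ _ CF Fb; exact: Fle bc.
  - move=> b c [F CF Fb] [G CG Gc].
    have [FG|GF] := Ctot _ _ CF CG.
      exists G => //; have [[_ _ GI _] _] := Cprop _ _ CG Gc.
      by apply: GI => //; exact: FG.
    exists F => //; have [[_ _ FI _] _] := Cprop _ _ CF Fb.
    by apply: FI => //; exact: GF.
  - move=> [F CF F_0]; have [[_ _ _ nF0] _] := Cprop _ _ CF F_0.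
    exact: nF0.
have Pup : P [set b | (e <= b)%O].
  right; split; last exact: lexx.
  split=> /=; first exact: lex1.
  - by move=> b c eb; exact: le_trans.
  - by move=> b c eb ec; rewrite lexI eb ec.
  - by rewrite lex0 => /eqP.
have [M1 Me] : proper_boolean_filter M /\ M e.
  case: PM => // M0; exfalso; apply: Mmax Pup; rewrite M0.
  by split=> // /(_ e (lexx e)).
exists (fun b => `[< M b >]); last exact/asboolP.
have [MT Mle MI M0] := M1.
apply: ultrafilter_boolean_hom => // b.
have [Mb|Mb] := pselect (M b); [by left | right].
(* [N] is the filter generated by [M] and [b]. As [b] is not in [M], maximality forces [N] to be
   improper, so some [m] in [M] is disjoint from [b], that is, lies below its complement. *)
pose N := [set c | exists2 m, M m & (m `&` b <= c)%O].
have MN : M `<=` N by move=> c Mc; exists c => //; exact: leIl.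
have Nb : N b by exists \top%O => //; exact: leIr.
have nPN : ~ P N by apply: Mmax; split=> // /(_ _ Nb).
have [m Mm mb] : N \bot%O.
  apply: contrapT => N0; apply: nPN; right; split; last exact: MN.
  split=> //; first exact: MN.
  - by move=> c c' [m Mm mc] cc'; exists m => //; exact: le_trans cc'.
  - move=> c c' [m Mm mc] [m' Mm' mc']; exists (m `&` m')%O; first exact: MI.
    rewrite lexI; apply/andP; split.
      by apply: le_trans mc; apply: leI2 => //; exact: leIl.
    by apply: le_trans mc'; apply: leI2 => //; exact: leIr.
apply: Mle Mm _.
have -> : m = ((m `&` b) `|` (m `&` ~` b))%O by rewrite -meetUr joinxC meetx1.
by move: mb; rewrite lex0 => /eqP ->; rewrite join0x; exact: leIr.
Qed.

End Ultrafilters.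

(** * The Stone space of a Boolean algebra *)

Section StoneSpace.
Variables (d : Order.disp_t) (B : ctbDistrLatticeType d).

(** Points are homomorphisms to [bool] rather than ultrafilters, so that the value of a point at [b]
    is directly the value of the indicator of [stone_basic b]. *)
Record stone_point := StonePoint {
  stone_fun :> B -> bool;
  stone_hom : is_boolean_hom stone_fun
}.

HB.instance Definition _ := gen_eqMixin stone_point.
HB.instance Definition _ := gen_choiceMixin stone_point.

Definition stone_basic (b : B) : set stone_point := [set s : stone_point | s b].

Lemma stone_basicT : stone_basic \top%O = setT.
Proof.
apply/seteqP; split=> // s _; rewrite /stone_basic /=.
by case: (stone_hom s) => _ ->.
Qed.

Lemma stone_basic0 : stone_basic \bot%O = set0.
Proof.
apply/seteqP; split=> // s; rewrite /stone_basic /=.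
by case: (stone_hom s) => ->.
Qed.

Lemma stone_basicI b c :
  stone_basic (b `&` c)%O = stone_basic b `&` stone_basic c.
Proof.
by apply/seteqP; split=> s; rewrite /stone_basic /=;
  case: (stone_hom s) => _ _ -> _ _; move/andP.
Qed.

Lemma stone_basicC b : stone_basic (~` b)%O = ~` stone_basic b.
Proof.
by apply/seteqP; split=> s; rewrite /stone_basic /=;
  case: (stone_hom s) => _ _ _ _ ->; move/negP.
Qed.

Let stone_open : set_system stone_point :=
  [set U : set stone_point | forall s : stone_point, U s ->
    exists2 b, s b & stone_basic b `<=` U].

Let stone_openT : stone_open setT.
Proof. by move=> s _; exists \top%O => //; case: (stone_hom s) => _ ->. Qed.

Let stone_openI : setI_closed stone_open.
Proof.
move=> U V oU oV s [/oU[b sb bU] /oV[c sc cV]]; exists (b `&` c)%O.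
  by case: (stone_hom s) => _ _ -> _ _; apply/andP.
by rewrite stone_basicI => t [/bU Ut /cV Vt].
Qed.

Let stone_open_bigU (I : Type) (f : I -> set stone_point) :
  (forall i, stone_open (f i)) -> stone_open (\bigcup_i f i).
Proof.
move=> of_ s [i _ /(of_ i)[b sb bf]]; exists b => // t bt.
by exists i => //; exact: bf.
Qed.

HB.instance Definition _ := isOpenTopological.Build stone_point
  stone_openT stone_openI stone_open_bigU.

Lemma stone_basic_open b : open (stone_basic b).
Proof. by have : stone_open (stone_basic b) by move=> t tb; exists b. Qed.

Lemma stone_nbhsP (s : stone_point) (U : set stone_point) :
  nbhs s U <-> exists2 b, s b & stone_basic b `<=` U.
Proof.
rewrite nbhsE /=; split=> [[V [oV Vs] VU]|[b sb bU]].
  have [b sb bV] : exists2 b, s b & stone_basic b `<=` V by exact: oV.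
  by exists b => //; exact: subset_trans VU.
by exists (stone_basic b) => //; split=> //; exact: stone_basic_open.
Qed.

Lemma stone_basic_clopen b : clopen (stone_basic b).
Proof.
split; first exact: stone_basic_open.
by rewrite -openC -stone_basicC; exact: stone_basic_open.
Qed.

Lemma stone_point_space : stone_space stone_point.
Proof.
split.
- split=> [U []//|s U /stone_nbhsP[b sb bU]].
  exists (stone_basic b) => //; split=> //; exact: stone_basic_clopen.
- rewrite compact_ultra => F uF _.
  (* The elements whose basic set belongs to the ultrafilter [F] form an ultrafilter of [B]; the
     corresponding point is a limit of [F]. *)
  pose M : set B := [set b | F (stone_basic b)].
  have M_hom : is_boolean_hom (fun b => `[< M b >]).
    apply: ultrafilter_boolean_hom.
      split; rewrite /M /=.
      + by rewrite stone_basicT; exact: filterT.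
      + move=> b c Fb bc; apply: filterS Fb => s; rewrite /stone_basic /= => sb.
        have [_ _ sI _ _] := stone_hom s.
        by move: sb; rewrite -(meet_l bc) sI => /andP[].
      + by move=> b c Fb Fc; rewrite stone_basicI; exact: filterI.
      + by rewrite stone_basic0; exact: filter_not_empty.
    by move=> b; rewrite /M /= stone_basicC; exact: in_ultra_setVsetC.
  exists (StonePoint M_hom); split=> // U /stone_nbhsP[b /asboolP Mb bU].
  exact: filterS Mb.
- move=> p q pq.
  (* Evaluation at [b] is locally constant. Since all neighbourhoods of [p] and [q] meet, the two
     points agree at every [b]. *)
  have nb (s : stone_point) b : nbhs s [set t : stone_point | t b = s b].
    have [sb|sb] := boolP (s b).
      by apply/stone_nbhsP; exists b.
    apply/stone_nbhsP; exists (~` b)%O.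
      by case: (stone_hom s) => _ _ _ _ ->; exact: sb.
    by rewrite stone_basicC => t /negP/negbTE.
  have e : stone_fun p = stone_fun q.
    apply/funext => b; have [r /= [<- <-//]] := pq _ _ (nb p b) (nb q b).
  move: p q e {pq nb} => [p hp] [q hq] /= e; case: q / e hq => hq.
  by congr StonePoint; exact: Prop_irrelevance.
Qed.

End StoneSpace.

(** * Indicators of clopen sets and generation of a Boolean power *)

Section BooleanPowers.
Variables (R : comPzRingType) (X : topologicalType).
Local Notation C := (boolean_power R X).
Implicit Types (f g : C) (U V : set X).

Lemma bp_addE f g x : (f + g) x = (f x : R) + g x. Proof. by []. Qed.
Lemma bp_mulE f g x : (f * g) x = (f x : R) * g x. Proof. by []. Qed.
Lemma bp_oppE f x : (- f) x = - (f x : R). Proof. by []. Qed.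
Lemma bp_mapE (a : R) x : (alg_map a : C) x = a. Proof. by []. Qed.
Lemma bp0E x : (0 : C) x = 0 :> R. Proof. by []. Qed.
Lemma bp1E x : (1 : C) x = 1 :> R. Proof. by []. Qed.
Definition bpE := (bp_addE, bp_mulE, bp_oppE, bp_mapE, bp0E, bp1E).

Lemma bp_preimage_clopen f (a : R) : clopen [set x | f x = a :> R].
Proof.
apply: (@preimage_clopen X (discrete_topology R) f [set a]).
  by split; [exact: discrete_open | exact: discrete_closed].
exact: cts_fun.
Qed.

Lemma indic_continuous U : clopen U ->
  continuous (fun x => (`[< U x >])%:R : discrete_topology R).
Proof.
move=> [oU cU] x; apply/discrete_cvg.
have [Ux|nUx] := pselect (U x).
  have : nbhs x U by exact: open_nbhs_nbhs.
  by apply: filterS => y Uy /=; rewrite !asboolT.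
have : nbhs x (~` U) by apply: open_nbhs_nbhs; split=> //; exact: closed_openC.
by apply: filterS => y nUy /=; rewrite !asboolF.
Qed.

Definition bp_indic U (hU : clopen U) : C := mkcts (indic_continuous hU).

Lemma bp_indicE U (hU : clopen U) x : bp_indic hU x = (`[< U x >])%:R :> R.
Proof. by []. Qed.

Lemma bp_indic_eq0 U (hU : clopen U) : U `<=` set0 -> bp_indic hU = 0.
Proof. by move=> U0; apply: bpP => x; rewrite bp_indicE asboolF // => /U0. Qed.

Lemma bp_indicT (hT : clopen setT) : bp_indic hT = 1.
Proof. by apply: bpP => x; rewrite bp_indicE asboolT. Qed.

Lemma bp_indicI U V (hU : clopen U) (hV : clopen V) :
  bp_indic (clopenI hU hV) = bp_indic hU * bp_indic hV.
Proof.
by apply: bpP => x; rewrite bpE !bp_indicE asbool_and -natrM mulnb.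
Qed.

Lemma bp_indicU U V (hU : clopen U) (hV : clopen V) :
  bp_indic (clopenU hU hV) =
  bp_indic hU + bp_indic hV - bp_indic hU * bp_indic hV.
Proof.
apply: bpP => x; rewrite !bpE !bp_indicE asbool_or.
by case: `[< U x >]; case: `[< V x >] => /=; ring.
Qed.

Lemma bp_indicC U (hU : clopen U) :
  bp_indic (clopenC U hU) = 1 - bp_indic hU.
Proof.
apply: bpP => x; rewrite !bpE !bp_indicE asbool_neg.
by case: `[< U x >] => /=; ring.
Qed.

(* The clopen sets [U] such that the indicator of [U] and its product with [f]
   lie in [D] form an ideal; if it were proper, the complements would have a
   cluster point. *)
Lemma boolean_power_generated (D : set C) :
  compact [set: X] -> is_subalgebra D ->
  (forall f x, exists U (hU : clopen U),
    [/\ U x, D (bp_indic hU) & forall y, U y -> f y = f x]) ->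
  forall f, D f.
Proof.
move=> cX [Da DD DM] Dloc f.
have DB u v : D u -> D v -> D (u - v).
  move=> Du Dv; have := DD _ _ Du (DM _ _ (Da (- 1)) Dv).
  by rewrite rmorphN rmorph1 mulN1r.
pose J U := exists hU : clopen U, D (bp_indic hU) /\ D (f * bp_indic hU).
have J0 : J set0.
  exists clopen0; rewrite bp_indic_eq0 // mulr0.
  by have := Da 0; rewrite rmorph0.
have JU U V : J U -> J V -> J (U `|` V).
  move=> [hU [DU DfU]] [hV [DV DfV]]; exists (clopenU hU hV).
  rewrite bp_indicU; split; first by apply: DB; [exact: DD | exact: DM].
  rewrite mulrBr mulrDr mulrA; apply: DB; first exact: DD.
  exact: DM.
have [[hT [_ DT]]|nJT] := pselect (J setT).
  by rewrite -(mulr1 f) -(bp_indicT hT).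
exfalso; pose F : set_system X := [set A | exists2 U, J U & ~` A `<=` U].
have FF : ProperFilter F.
  split.
    move=> [U JU']; rewrite setC0 => TU; apply: nJT.
    by have <- : U = setT by apply/seteqP; split.
  split.
  - by exists set0 => //; rewrite setCT.
  - move=> P Q [U JU' PU] [V JV QV]; exists (U `|` V); first exact: JU.
    by rewrite setCI; exact: setUSS.
  - move=> P Q PQ [U JU' PU]; exists U => //.
    by apply: subset_trans PU; exact: subsetC.
have [|p [_ Fp]] := cX F FF; first by exists set0 => //; rewrite setCT.
(* On a suitable clopen [U] around [p], [f] is constant, so [f] times the indicator of [U] is a
   scalar multiple of that indicator. Thus [U] is in [J] and its complement in [F], although [p] is
   a cluster point of [F]. *)
have [U [hU [Up DU fU]]] := Dloc f p.
have JU' : J U.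
  exists hU; split=> //.
  suff -> : f * bp_indic hU = alg_map (f p : R) * bp_indic hU.
    by apply: DM => //; exact: Da.
  apply: bpP => x; rewrite !bpE !bp_indicE.
  have [Ux|nUx] := pselect (U x); first by rewrite fU.
  by rewrite asboolF // !mulr0.
have FU : F (~` U) by exists U => //; rewrite setCK.
have [|x [nUx Ux]] := Fp _ _ FU (_ : nbhs p U); last exact: nUx.
by apply: open_nbhs_nbhs; split=> //; exact: (proj1 hU).
Qed.

End BooleanPowers.

(** * [R[B]] as the Boolean power of [R] by [B] *)

Section StoneRepresentation.
Variables (R : comPzRingType) (d : Order.disp_t) (B : ctbDistrLatticeType d).
Local Notation C := (boolean_power R (stone_point B)).

Definition stone_indic (b : B) : C := bp_indic R (stone_basic_clopen b).

Lemma stone_indicE b (s : stone_point B) : stone_indic b s = (s b)%:R :> R.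
Proof. by rewrite bp_indicE asboolb. Qed.

Lemma stone_indic_valued : boolean_valued stone_indic.
Proof.
split=> [b c|b c|b|]; apply: bpP => s; rewrite ?bpE !stone_indicE;
  case: (stone_hom s) => s0 _ sI sU sC.
- by rewrite sI; case: (s b); case: (s c); rewrite /= ?mulr1 ?mulr0.
- by rewrite sU; case: (s b); case: (s c) => /=; ring.
- by rewrite sC; case: (s b) => /=; ring.
by rewrite s0.
Qed.

Lemma boolean_algebra_alg_iso_power : alg_iso (boolean_algebra_alg R B) C.
Proof.
apply: (boolean_algebra_alg_iso stone_indic_valued).
  (* A point [s] of the basic set of [e] exists, and evaluating [a] times the indicator at [s] gives
     [a]. *)
  move=> e a e0 ae; have [s hs se] := exists_boolean_hom e0.
  have := congr1 (fun f : C => f (StonePoint hs) : R) ae.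
  by rewrite bpE stone_indicE /= se mulr1.
apply/generates_algP => D Dalg DG.
have [_ cX _] := stone_point_space B.
apply: (boolean_power_generated cX Dalg) => f s.
have : nbhs s [set t | f t = f s :> R].
  by apply: open_nbhs_nbhs; split=> //; case: (bp_preimage_clopen f (f s)).
move=> /stone_nbhsP[b sb bf]; exists (stone_basic b), (stone_basic_clopen b).
by split=> //; apply: DG; exists b.
Qed.

End StoneRepresentation.

(** * Idempotents of an algebra coming from clopen sets *)

Section ClopenIdempotents.
Variables (R : comPzRingType) (S : comPzAlgType R) (X : topologicalType).
Local Notation C := (boolean_power R X).
Variables (phi : C -> S).
Hypotheses (hphi : alg_hom phi).

(** Only indicators are taken, not all idempotents of [S]: if [R] has an idempotent other than [0]
    and [1], the corresponding constant function is idempotent but not faithful. *)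
Definition clopen_idem : {pred idem S} := fun e =>
  `[< exists U (hU : clopen U), idem_val e = phi (bp_indic R hU) >].

Let clopen_idemP (e : idem S) : reflect
  (exists U (hU : clopen U), idem_val e = phi (bp_indic R hU))
  (e \in clopen_idem).
Proof. exact: asboolP. Qed.

Lemma clopen_idem_bot : \bot%O \in clopen_idem.
Proof.
apply/clopen_idemP; exists set0, clopen0.
by rewrite bp_indic_eq0 // (alg_hom0 hphi).
Qed.

Lemma clopen_idem_top : \top%O \in clopen_idem.
Proof.
apply/clopen_idemP; exists setT, clopenT.
by rewrite bp_indicT (alg_hom1 hphi).
Qed.

Lemma clopen_idem_meet :
  {in clopen_idem &, forall e f, (e `&` f)%O \in clopen_idem}.
Proof.
move=> e f /clopen_idemP[U [hU eU]] /clopen_idemP[V [hV fV]].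
apply/clopen_idemP; exists (U `&` V), (clopenI hU hV).
by rewrite bp_indicI (alg_homM hphi) -eU -fV.
Qed.

Lemma clopen_idem_compl :
  {in clopen_idem, forall e, (~` e)%O \in clopen_idem}.
Proof.
move=> e /clopen_idemP[U [hU eU]].
apply/clopen_idemP; exists (~` U), (clopenC U hU).
by rewrite bp_indicC (alg_homB hphi) (alg_hom1 hphi) -eU.
Qed.

Lemma clopen_idem_join :
  {in clopen_idem &, forall e f, (e `|` f)%O \in clopen_idem}.
Proof.
move=> e f he hf; rewrite -[(e `|` f)%O]complK complU.
by apply: clopen_idem_compl; apply: clopen_idem_meet; apply: clopen_idem_compl.
Qed.

Definition clopen_subalg : boolSubalg (idem S) :=
  BoolSubalg clopen_idem_bot clopen_idem_top clopen_idem_meet clopen_idem_join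
    clopen_idem_compl.

Lemma bp_indic_idem U (hU : clopen U) :
  phi (bp_indic R hU) * phi (bp_indic R hU) == phi (bp_indic R hU).
Proof.
rewrite -(alg_homM hphi); apply/eqP; congr phi; apply: bpP => x.
by rewrite bpE bp_indicE -natrM mulnb andbb.
Qed.

Lemma clopen_subalg_elt U (hU : clopen U) :
  exists e : bs_sort clopen_subalg, idem_val (bs_val e) = phi (bp_indic R hU).
Proof.
have he : Idem (bp_indic_idem hU) \in bs_pred clopen_subalg.
  by apply/clopen_idemP; exists U, hU.
by exists (BsElt he).
Qed.

Lemma clopen_subalg_generating :
  compact [set: X] -> (forall u, exists f, phi f = u) ->
  generating clopen_subalg.
Proof.
move=> cX phi_surj; apply/generates_algP => D Dalg DG u.
have [f <-] := phi_surj u.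
apply: (boolean_power_generated cX (alg_hom_preimage hphi Dalg)) => g x.
(* The clopen set required around [x] is the fibre of [g] through [x]. *)
have hU := bp_preimage_clopen g (g x); exists _, hU; split=> //=.
have [e eE] := clopen_subalg_elt hU.
by rewrite -eE; apply: DG; exists (bs_val e) => //; exact: bs_valP.
Qed.

(* The sets whose idempotent [sigma] sends to [true] generate a filter; [x] is
   one of its cluster points. *)
Lemma clopen_subalg_hom_point (sigma : bs_sort clopen_subalg -> bool) :
  compact [set: X] -> injective phi -> is_boolean_hom sigma ->
  exists x : X, forall (e : bs_sort clopen_subalg) U (hU : clopen U),
    idem_val (bs_val e) = phi (bp_indic R hU) -> sigma e = `[< U x >].
Proof.
move=> cX phi_inj [s0 s1 sI _ sC].
pose F : set_system X := [set A | exists (e : bs_sort clopen_subalg) U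
  (hU : clopen U), [/\ idem_val (bs_val e) = phi (bp_indic R hU), sigma e
    & U `<=` A]].
have FT : F setT.
  have [U [hU eU]] := clopen_idemP _ clopen_idem_top.
  by exists \top%O, U, hU; split=> //; rewrite s1.
have FF : ProperFilter F.
  split.
    move=> [e [U [hU [eU se U0]]]].
    (* [F] is proper: the empty set represents only the bottom idempotent, which [sigma] sends to
       [false]. *)
    suff e0 : e = \bot%O by move: se; rewrite e0 s0.
    by apply/val_inj/val_inj; rewrite /= eU bp_indic_eq0 // (alg_hom0 hphi).
  split=> //.
  - move=> P Q [e [U [hU [eU se UP]]]] [f [V [hV [fV sf VQ]]]].
    exists (e `&` f)%O, (U `&` V), (clopenI hU hV); split.
    + by rewrite bp_indicI (alg_homM hphi) -eU -fV.
    + by rewrite sI; apply/andP.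
    + exact: setISS.
  - move=> P Q PQ [e [U [hU [eU se UP]]]]; exists e, U, hU; split=> //.
    exact: subset_trans PQ.
have [x [_ Fx]] := cX F FF FT.
(* A closed member of [F] contains the cluster point [x]. Applied to [U] or to its complement,
   according to [sigma e], this decides whether [x] lies in [U]. *)
have Fcl U : clopen U -> F U -> U x.
  move=> [_ cU] FU; apply: cU => V xV; exact: Fx.
exists x => e U hU eU; have [se|nse] := boolP (sigma e).
  have Ux : U x by apply: Fcl => //; exists e, U, hU; split.
  by rewrite asboolT.
suff nUx : ~ U x by rewrite asboolF.
apply: (Fcl (~` U)); first exact: clopenC.
exists (~` e)%O, (~` U), (clopenC U hU); split=> //; last by rewrite sC.
by rewrite bp_indicC (alg_homB hphi) (alg_hom1 hphi) -eU.
Qed.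

End ClopenIdempotents.

(** * Boolean subalgebras of [Id(S)] and the four equivalent conditions *)

Section Idempotents.
Variables (R : comPzRingType) (S : comPzAlgType R) (B : boolSubalg (idem S)).

Lemma bs_val_valued : boolean_valued (fun e : bs_sort B => idem_val (bs_val e)).
Proof. by split. Qed.

Lemma bs_val_range :
  range (fun e : bs_sort B => idem_val (bs_val e)) =
  [set idem_val e | e in [set` bs_pred B]].
Proof.
apply/seteqP; split=> [_ [e _ <-]|_ [e eB <-]].
  by exists (bs_val e) => //; exact: bs_valP.
by exists (BsElt eB).
Qed.

End Idempotents.

Theorem theorem2p7 (R : comPzRingType) (S : comPzAlgType R) :
  [<-> specker S;
       exists (d : Order.disp_t) (B : ctbDistrLatticeType d),
         alg_iso S (boolean_algebra_alg R B);
       exists X : topologicalType,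
         stone_space X /\ alg_iso S (boolean_power R X);
       exists B : boolSubalg (idem S),
         generating B /\
         forall sigma : bs_sort B -> bool, is_boolean_hom sigma ->
         exists alpha : S -> R^o, alg_hom alpha /\
           forall e : bs_sort B,
             alpha (idem_val (bs_val e)) = if sigma e then 1 else 0].
Proof.
tfae.
(* (1) implies (2): the inclusion of [B] into [S] has faithful nonzero values and generates [S]. *)
- move=> [B [gB fB]]; exists _, (bs_sort B); apply: alg_iso_sym.
  apply: (boolean_algebra_alg_iso (bs_val_valued B)).
    move=> e a e0 ae; apply: (proj2 (fB _ (bs_valP e) _)) ae.
    by move=> ve0; apply: e0; do 2 apply: val_inj.
  by rewrite bs_val_range.
- move=> [d [B SB]]; exists (stone_point B); split.
    exact: stone_point_space.
  exact: alg_iso_trans (boolean_algebra_alg_iso_power R B).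
- move=> [X [[_ cX _] [psi [hpsi [phi psiK phiK]]]]].
  have hphi := alg_hom_inv hpsi psiK phiK.
  exists (clopen_subalg hphi); split.
    by apply: clopen_subalg_generating => // u; exists (psi u).
  move=> sigma hsigma.
  have [x xE] := clopen_subalg_hom_point cX (can_inj phiK) hsigma.
  (* The lift is evaluation at [x], transported to [S] along the isomorphism [psi]. *)
  exists (fun u => psi u x); split.
    split.
    - by split=> [|u v]; rewrite ?(alg_hom0 hpsi) ?(alg_homD hpsi).
    - by split=> [|u v]; rewrite ?(alg_hom1 hpsi) ?(alg_homM hpsi).
    by move=> a; rewrite (alg_hom_map hpsi).
  move=> e; have [U [hU eU]] := asboolP _ (bs_valP e).
  by rewrite (xE _ _ _ eU) eU phiK bp_indicE; case: `[< U x >].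
(* (4) implies (1): a homomorphism sending the nonzero [e] to [true] has a lift [alpha], and
   applying [alpha] to the equation [ae] leaves [a = 0]. *)
move=> [B [gB lift]]; exists B; split=> // e eB e0; split=> // a ae.
have [|sigma hs se] := @exists_boolean_hom _ _ (BsElt eB : bs_sort B).
  by move=> /(congr1 (fun e => idem_val (bs_val e))).
have [alpha [halpha alphaE]] := lift _ hs.
have := congr1 alpha ae.
by rewrite (alg_homM halpha) (alg_hom_map halpha) (alphaE (BsElt eB)) se
  (alg_hom0 halpha) mulr1.
Qed.
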